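(* Let $R$ be the pullback ring of ring epimorphisms $R_1\xrightarrow{v_1}\overline R\xleftarrow{v_2}R_2$, and assume that $\overline R$ is semisimple. Then every $R$-module $M$ has a separated presentation $f\colon K\to S$, given by a triple $(f_1,\bar f,f_2)$, such that (1) $K$ is the pullback of $K\xrightarrow{\mathrm{id}}K\xleftarrow{\mathrm{id}}K$ (that is, in the diagram of $K$ one has $K_1=\overline K=K_2$ and $q_1=q_2=\mathrm{id}$), and (2) both $f_1$ and $f_2$ are monomorphisms, and $\bar f=0$.
   Context: Rings are unital and modules are (left) modules. $v_1,v_2$ are surjective ring homomorphisms, $R=\{(r_1,r_2)\in R_1\oplus R_2: v_1(r_1)=v_2(r_2)\}$, and $P_i=\ker v_i$. Any $\overline R$-module is an $R_i$-module via $v_i$. Given $R_i$-modules $S_i$ ($i=1,2$), an $\overline R$-module $\overline S$ and $R_i$-linear maps $p_i\colon S_i\to\overline S$, the pullback $S=\{(s_1,s_2): p_1(s_1)=p_2(s_2)\}$ is an $R$-module by $(r_1,r_2)(s_1,s_2)=(r_1s_1,r_2s_2)$; it is called a pullback module with pullback diagram $S_1\xrightarrow{p_1}\overline S\xleftarrow{p_2}S_2$. The diagram is separated if each $p_i$ is surjective and $\ker p_i=P_iS_i$; an $R$-module is separated if it is (isomorphic to) the pullback of a separated diagram. A pullback presentation of an $R$-module $M$ is a homomorphism $f\colon K\to S$ of pullback modules with $M\cong\operatorname{coker} f$, which is the pullback of a commuting diagram consisting of pullback diagrams $K_1\xrightarrow{q_1}\overline K\xleftarrow{q_2}K_2$ of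 $K$ and $S_1\xrightarrow{p_1}\overline S\xleftarrow{p_2}S_2$ of $S$, $R_i$-linear maps $f_i\colon K_i\to S_i$ and an $\overline R$-linear map $\bar f\colon\overline K\to\overline S$ with $p_if_i=\bar fq_i$; thus $f(k_1,k_2)=(f_1(k_1),f_2(k_2))$. It is a separated presentation if both $K$ and $S$ are separated; in this case the diagrams used for $K$ and $S$ are the separated ones, i.e. $q_i,p_i$ are surjective, $\ker q_i=P_iK_i$ and $\ker p_i=P_iS_i$. *)

(* Defs.v *)
From HB Require Import structures.
From mathcomp Require Import all_boot all_algebra.
From mathcomp Require Import boolp.

Set Implicit Arguments.
Unset Strict Implicit.
Unset Printing Implicit Defensive.

Import GRing.Theory.
Local Open Scope ring_scope.
Local Open Scope quotient_scope.

(* All rings are unital, not necessarily commutative, and possibly zero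
   (pzRingType); lmodType is the type of left modules.  Submodules are boolean
   predicates, which is no restriction in the presence of classical logic. *)

Definition surj (A B : Type) (f : A -> B) : Prop := forall y, exists x, f x = y.

Section Semisimple.
Variables (R : pzRingType) (V : lmodType R).

Definition simple_submod (N : {pred V}) : Prop :=
  [/\ submod_closed N,
      exists2 x, x \in N & x != 0
    & forall N' : {pred V}, submod_closed N' -> {subset N' <= N} ->
        {in N', forall x, x = 0} \/ {subset N <= N'}].

(* V is the internal direct sum of a family of simple submodules. *)
Definition semisimple_mod : Prop :=
  exists (I : choiceType) (N : I -> {pred V}),
    [/\ forall i, simple_submod (N i),
        forall x, exists (s : seq I) (y : I -> V),
          [/\ uniq s, forall i, y i \in N i & x = \sum_(i <- s) y i]
      & forall (s : seq I) (y : I -> V), uniq s -> (forall i, y i \in N i) ->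
          \sum_(i <- s) y i = 0 -> {in s, forall i, y i = 0}].

End Semisimple.

Definition semisimple_ring (R : pzRingType) : Prop := semisimple_mod R^o.

Definition lmod_isomorphic (R : pzRingType) (U V : lmodType R) : Prop :=
  exists g : {linear U -> V}, bijective g.

Section Coker.
Variables (R : pzRingType) (U V : lmodType R) (f : {linear U -> V}).

Definition im_pred : {pred V} := fun y => `[< exists x, f x = y >].

Lemma im_predP y : reflect (exists x, f x = y) (y \in im_pred).
Proof. exact: asboolP. Qed.

Lemma im_zmod_closed : zmod_closed im_pred.
Proof.
split; first by apply/im_predP; exists 0; rewrite raddf0.
move=> _ _ /im_predP[x <-] /im_predP[y <-]; apply/im_predP.
by exists (x - y); rewrite raddfB.
Qed.
HB.instance Definition _ := GRing.isZmodClosed.Build V im_pred im_zmod_closed.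

Definition coker : Type := Quotient.quot im_pred.
HB.instance Definition _ := GRing.Zmodule.on coker.
HB.instance Definition _ := EqQuotient.on coker.

Definition coker_scale (a : R) (x : coker) : coker := \pi_coker (a *: repr x).

Lemma coker_eqP (x y : V) :
  reflect (exists u, f u = x - y) (\pi_coker x == \pi_coker y).
Proof.
by rewrite -(Quotient.idealrBE im_pred); apply: im_predP.
Qed.

Lemma coker_pi_add (x y : V) :
  \pi_coker (x + y) = \pi_coker x + \pi_coker y :> coker.
Proof. exact: (Quotient.pi_add im_pred). Qed.

Lemma coker_pi_scale (a : R) (x : V) :
  coker_scale a (\pi_coker x) = \pi_coker (a *: x).
Proof.
apply/eqP/coker_eqP.
have /coker_eqP[u fu] : \pi_coker (repr (\pi_coker x)) == \pi_coker x.
  by rewrite reprK.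
by exists (a *: u); rewrite linearZ /= fu scalerBr.
Qed.

Lemma coker_scaleA a b x :
  coker_scale a (coker_scale b x) = coker_scale (a * b) x.
Proof.
rewrite -[x]reprK (coker_pi_scale b) (coker_pi_scale a).
by rewrite (coker_pi_scale (a * b)) scalerA. Qed.

Lemma coker_scale1 : left_id 1 coker_scale.
Proof. by move=> x; rewrite -[x]reprK coker_pi_scale scale1r. Qed.

Lemma coker_scaleDr : right_distributive coker_scale +%R.
Proof.
move=> a x y; rewrite -[x]reprK -[y]reprK.
by rewrite -coker_pi_add !coker_pi_scale -coker_pi_add scalerDr.
Qed.

Lemma coker_scaleDl x : {morph coker_scale^~ x : a b / a + b}.
Proof.
move=> a b /=; rewrite -[x]reprK.
by rewrite !coker_pi_scale -coker_pi_add scalerDl.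
Qed.

HB.instance Definition _ := GRing.Zmodule_isLmodule.Build R coker
  coker_scaleA coker_scale1 coker_scaleDr coker_scaleDl.

End Coker.

(* The R-module obtained from an R'-module L by restriction of scalars along
   v : R -> R'. *)
Definition restr (R R' : pzRingType) (v : {rmorphism R -> R'})
  (L : lmodType R') : Type := L.

Section Restriction.
Variables (R R' : pzRingType) (v : {rmorphism R -> R'}) (L : lmodType R').

Local Notation restr := (restr v L).
HB.instance Definition _ := GRing.Zmodule.copy restr L.

Definition restr_scale (a : R) (x : restr) : restr := v a *: (x : L).

Lemma restr_scaleA a b x :
  restr_scale a (restr_scale b x) = restr_scale (a * b) x.
Proof. by rewrite /restr_scale scalerA rmorphM. Qed.

Lemma restr_scale1 : left_id 1 restr_scale.
Proof. by move=> x; rewrite /restr_scale rmorph1 scale1r. Qed.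

Lemma restr_scaleDr : right_distributive restr_scale +%R.
Proof. by move=> a x y; apply: scalerDr. Qed.

Lemma restr_scaleDl x : {morph restr_scale^~ x : a b / a + b}.
Proof. by move=> a b; rewrite /restr_scale rmorphD; apply: scalerDl. Qed.

HB.instance Definition _ := GRing.Zmodule_isLmodule.Build R restr
  restr_scaleA restr_scale1 restr_scaleDr restr_scaleDl.

Definition restr_id (x : restr) : L := x.

Lemma restr_id_linear : linear_for (v \; *:%R) restr_id.
Proof. by []. Qed.
HB.instance Definition _ :=
  GRing.isLinear.Build R restr L (v \; *:%R) restr_id restr_id_linear.

End Restriction.

Section Pullback.
Variables (R1 R2 Rbar : pzRingType).
Variables (v1 : {rmorphism R1 -> Rbar}) (v2 : {rmorphism R2 -> Rbar}).

Definition pbring_pred : {pred R1 * R2} := fun r => v1 r.1 == v2 r.2.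

Lemma pbring_closed : subring_closed pbring_pred.
Proof.
split; first by rewrite unfold_in /= !rmorph1.
- by move=> x y; rewrite !unfold_in /= => /eqP ex /eqP ey; rewrite !rmorphB ex ey.
- by move=> x y; rewrite !unfold_in /= => /eqP ex /eqP ey; rewrite !rmorphM ex ey.
Qed.
HB.instance Definition _ :=
  GRing.isSubringClosed.Build (R1 * R2)%type pbring_pred pbring_closed.

Record pbring := PbRing { pbring_val : R1 * R2; _ : pbring_val \in pbring_pred }.
HB.instance Definition _ := [isSub for pbring_val].
HB.instance Definition _ := [Choice of pbring by <:].
HB.instance Definition _ :=
  GRing.SubChoice_isSubPzRing.Build (R1 * R2)%type pbring_pred pbring
    pbring_closed.

(* R_i-linearity of S_i -> Sbar, with R_i acting on Sbar via v_i, is linearity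
   for the scaling (v_i \; *:%R). *)
Record pbdiag := PbDiag {
  pb1 : lmodType R1;
  pbbar : lmodType Rbar;
  pb2 : lmodType R2;
  pbp1 : {linear pb1 -> pbbar | v1 \; *:%R};
  pbp2 : {linear pb2 -> pbbar | v2 \; *:%R} }.

Section PullbackModule.
Variable S : pbdiag.

Definition pbmod_pred : {pred pb1 S * pb2 S} := fun s => pbp1 S s.1 == pbp2 S s.2.

Lemma pbmod_closed : zmod_closed pbmod_pred.
Proof.
split; first by rewrite unfold_in /= !raddf0.
by move=> x y; rewrite !unfold_in /= => /eqP ex /eqP ey; rewrite !raddfB /= ex ey.
Qed.
HB.instance Definition _ :=
  GRing.isZmodClosed.Build (pb1 S * pb2 S)%type pbmod_pred pbmod_closed.

Record pbmod : Type :=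
  PbMod { pbmod_val : pb1 S * pb2 S; pbmodP : pbmod_val \in pbmod_pred }.
HB.instance Definition _ := [isSub for pbmod_val].
HB.instance Definition _ := [Choice of pbmod by <:].
HB.instance Definition _ := [SubChoice_isSubZmodule of pbmod by <:].

Lemma pbmod_scale_subproof (r : pbring) (s : pbmod) :
  ((val r).1 *: (val s).1, (val r).2 *: (val s).2) \in pbmod_pred.
Proof.
case: r s => [r Pr] [s Ps] /=; move: Pr Ps; rewrite !unfold_in /=.
by move=> /eqP er /eqP es; rewrite !linearZ /= er es.
Qed.
Definition pbmod_scale (r : pbring) (s : pbmod) : pbmod :=
  PbMod (pbmod_scale_subproof r s).

Lemma pbmod_scaleA a b x :
  pbmod_scale a (pbmod_scale b x) = pbmod_scale (a * b) x.
Proof. by apply: val_inj; rewrite /= !scalerA. Qed.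

Lemma pbmod_scale1 : left_id 1 pbmod_scale.
Proof. by move=> x; apply: val_inj; rewrite /= !scale1r; case: (val x). Qed.

Lemma pbmod_scaleDr : right_distributive pbmod_scale +%R.
Proof. by move=> a x y; apply: val_inj; rewrite /= !scalerDr. Qed.

Lemma pbmod_scaleDl x : {morph pbmod_scale^~ x : a b / a + b}.
Proof. by move=> a b; apply: val_inj; rewrite /= !scalerDl. Qed.

HB.instance Definition _ := GRing.Zmodule_isLmodule.Build pbring pbmod
  pbmod_scaleA pbmod_scale1 pbmod_scaleDr pbmod_scaleDl.

End PullbackModule.

(* The submodule (ker v) V of V, i.e. the finite sums of products. *)
Definition ker_smul (R : pzRingType) (v : {rmorphism R -> Rbar})
    (V : lmodType R) (x : V) : Prop :=
  exists (n : nat) (a : 'I_n -> R) (y : 'I_n -> V),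
    (forall i, v (a i) = 0) /\ x = \sum_(i < n) a i *: y i.

Definition separated (S : pbdiag) : Prop :=
  [/\ surj (pbp1 S), surj (pbp2 S),
      forall x, pbp1 S x = 0 <-> ker_smul v1 x
    & forall x, pbp2 S x = 0 <-> ker_smul v2 x].

Record pbhom (K S : pbdiag) := PbHom {
  pbf1 : {linear pb1 K -> pb1 S};
  pbfbar : {linear pbbar K -> pbbar S};
  pbf2 : {linear pb2 K -> pb2 S};
  pbhom1 : forall x, pbp1 S (pbf1 x) = pbfbar (pbp1 K x);
  pbhom2 : forall x, pbp2 S (pbf2 x) = pbfbar (pbp2 K x) }.

Section PullbackMap.
Variables (K S : pbdiag) (F : pbhom K S).

Lemma pbmap_subproof (k : pbmod K) :
  (pbf1 F (val k).1, pbf2 F (val k).2) \in @pbmod_pred S.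
Proof.
case: k => k Pk /=; move: Pk; rewrite !unfold_in /= => /eqP ek.
by rewrite pbhom1 pbhom2 ek.
Qed.
Definition pbmap (k : pbmod K) : pbmod S := PbMod (pbmap_subproof k).

Lemma pbmap_linear : linear pbmap.
Proof. by move=> a x y; apply: val_inj; rewrite /= !linearP. Qed.
HB.instance Definition _ :=
  GRing.isLinear.Build pbring (pbmod K) (pbmod S) *:%R pbmap pbmap_linear.

End PullbackMap.

Definition pb_presentation (M : lmodType pbring) (K S : pbdiag)
    (F : pbhom K S) : Prop :=
  lmod_isomorphic M (coker (pbmap F)).

Definition separated_presentation (M : lmodType pbring) (K S : pbdiag)
    (F : pbhom K S) : Prop :=
  [/\ pb_presentation M F, separated K & separated S].

Definition id_pbdiag (L : lmodType Rbar) : pbdiag :=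
  @PbDiag (restr v1 L) L (restr v2 L) (@restr_id _ _ v1 L) (@restr_id _ _ v2 L).

End Pullback.

(* Main.v *)
From HB Require Import structures.
From mathcomp Require Import all_boot all_algebra.
From mathcomp Require Import boolp classical_sets functions fsbigop.
Require Import Defs.

(** Write [P_i] for the kernel of [v_i].  An [R]-module [S] is the pullback of a
separated diagram exactly when [P_1 S] and [P_2 S] meet in zero, so free modules
are separated, and [M] is a quotient [e : F -> M] of one of them
([separated_cover]).  The kernel [N] of [e] is then cut down in two steps, each
of which keeps the cover separated.

The first step divides [F] by the part of [N] lying in [P_1 F], that is the
elements [(x, 0)] of [N], and by the part lying in [P_2 F] ([reduced_cover]).
The new kernel [K] meets [P_1 S] and [P_2 S] trivially: an element of [K] with
one zero component is zero.  As [P_i K] lies in [K] and in [P_i S], it vanishes,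
so [K] is a module over [Rbar].

The second step is where semisimplicity enters ([small_kernel_cover]).  The image
of [K] in [Sbar] has a complement [D] ([semisimple_complement]), and [S] is
replaced by the preimage of [D].  This still maps onto [M], because every element
of [S] differs from one over [D] by an element of [K]; and the part of [K] that
survives maps to zero in [Sbar].  The diagram stays separated because [P_i] kills
the elements of [K] that are subtracted: [P_i S_i] is already generated from
the preimage of [D].

For the resulting cover, [f] is the inclusion of [K], seen as the pullback of two
identity maps: its components are injective by the first step and it induces
zero on [Kbar] by the second ([ker_presentation]). *)

Set Implicit Arguments.
Unset Strict Implicit.
Unset Printing Implicit Defensive.

Import GRing.Theory.
Local Open Scope ring_scope.
Local Open Scope quotient_scope.

(** * Complements over a semisimple ring *)

(** By Zorn's lemma, take [D] maximal among the submodules meeting [N] in zero.  To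
see that [N + D] is everything, write [1] as a sum of elements of simple left
ideals; it then suffices that [y *: x] lies in [N + D] for [y] in a simple left
ideal [Y].  The [y] in [Y] with this property form a left ideal, which is [Y] or
zero; in the latter case [Y x] meets [N + D] trivially and can be added to [D],
so that it was already contained in [D]. *)
Lemma semisimple_complement (A : pzRingType) (V : lmodType A) (N : {pred V}) :
  semisimple_ring A -> submod_closed N ->
  exists D : {pred V}, [/\ submod_closed D, forall x, x \in N -> x \in D -> x = 0
    & forall x, exists2 n, n \in N & x - n \in D].
Proof.
move=> [I [Y [simpleY spanY _]]] clN; have [N0 NP] := clN.
(* Not containing 0 is allowed here, so that the empty chain has a union in P. *)
pose P (D : set V) := (forall a x y, D x -> D y -> D (a *: x + y)) /\
  (forall x, x \in N -> D x -> x = 0).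
have [F FP Ftot|D [[Dlin DN] Dmax]] := @Zorn_bigcup V P.
  split=> [a x y [X FX Xx] [Z FZ Zy]|x Nx [X FX Xx]]; last exact: (FP X FX).2 x Nx Xx.
  have [XZ|ZX] := Ftot X Z FX FZ.
    by exists Z => //; apply: (FP Z FZ).1 => //; apply: XZ.
  by exists X => //; apply: (FP X FX).1 => //; apply: ZX.
have D0 : D 0.
  apply: contrapT => D0; apply: (Dmax [set 0]%classic).
    split=> [x Dx|/(_ 0 erefl)//].
    by case: D0; rewrite -(addNr x) -scaleN1r; apply: Dlin.
  by split=> [a x y -> ->|x _ ->//]; rewrite scaler0 addr0.
have DB x y : D x -> D y -> D (x - y).
  by move=> Dx Dy; rewrite -scaleN1r addrC; apply: Dlin.
pose ND : {pred V} := fun x => `[< exists2 n, n \in N & D (x - n) >].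
have ND_P x : reflect (exists2 n, n \in N & D (x - n)) (x \in ND) by exact: asboolP.
have NDlin : submod_closed ND.
  split; first by apply/ND_P; exists 0; rewrite ?subr0.
  move=> a x y /ND_P[n Nn Dn] /ND_P[m Nm Dm]; apply/ND_P.
  exists (a *: n + m); first exact: NP.
  by rewrite opprD addrACA -scalerBr; apply: Dlin.
have [ND0 NDP] := NDlin.
(* A submodule meeting N + D trivially can be added to D. *)
have absorb (T : {pred V}) : submod_closed T ->
    (forall t, t \in T -> t \in ND -> t = 0) -> forall t, t \in T -> D t.
  move=> [T0 TP] TND t Tt; apply: contrapT => nDt.
  pose B : set V := fun x => exists2 t, t \in T & D (x - t).
  apply: (Dmax B).
    split=> [x Dx|/(_ t)]; first by exists 0; rewrite ?subr0.
    by move=> BD; apply/nDt/BD; exists t => //; rewrite subrr.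
  split=> [a x y [u Tu Du] [w Tw Dw]|x Nx [u Tu Du]].
    by exists (a *: u + w); [apply: TP | rewrite opprD addrACA -scalerBr; apply: Dlin].
  have u0 : u = 0.
    apply: TND => //; apply/ND_P; exists x => //.
    by rewrite -opprB -[- _]add0r; apply: DB.
  by apply: DN => //; rewrite u0 subr0 in Du.
have allND x : x \in ND.
  have simple_smul i (y : A) : y \in Y i -> y *: x \in ND.
    have [[Y0 YP] _ Ymin] := simpleY i; move=> Yy.
    pose Y' : {pred A^o} := fun z => (z \in Y i) && ((z : A) *: x \in ND).
    have Y'P z : z \in Y' = (z \in Y i) && ((z : A) *: x \in ND) by [].
    have [| |Y'0|YY'] := Ymin Y'.
    - split=> [|a u w]; first by rewrite Y'P scale0r ND0 Y0.
      rewrite !Y'P => /andP[Yu NDu] /andP[Yw NDw].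
      by rewrite YP //= scalerDl -scalerA NDP.
    - by move=> z /andP[].
    - pose T : {pred V} := fun t => `[< exists2 z : A^o, z \in Y i & (z : A) *: x = t >].
      have TP t : reflect (exists2 z : A^o, z \in Y i & (z : A) *: x = t) (t \in T).
        exact: asboolP.
      apply/ND_P; exists 0; rewrite // subr0; apply: (absorb T).
      + split; first by apply/TP; exists 0; rewrite ?scale0r.
        move=> a _ _ /TP[u Yu <-] /TP[w Yw <-]; apply/TP.
        by exists (a *: u + w); rewrite ?YP // scalerA -scalerDl.
      + move=> t /TP[z Yz <-] NDz; rewrite (Y'0 z) ?scale0r //.
        by rewrite Y'P Yz.
      + by apply/TP; exists y.
    - by have := YY' _ Yy; rewrite Y'P => /andP[].
  have [s [y [_ Yy sumy]]] := spanY 1.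
  rewrite -[x]scale1r (sumy : (1 : A) = \sum_(i <- s) (y i : A)) scaler_suml.
  apply: (big_ind (fun z => z \in ND)) => [//|u w NDu NDw|i _].
    by rewrite -[u]scale1r NDP.
  exact: simple_smul (Yy i).
exists (fun x => `[< D x >]); split.
- split=> [|a x y]; first exact/asboolP.
  by move=> /asboolP Dx /asboolP Dy; apply/asboolP/Dlin.
- by move=> x Nx /asboolP; apply: DN.
- by move=> x; have /ND_P[n Nn Dn] := allND x; exists n => //; apply/asboolP.
Qed.

(** * Submodules, quotients and change of rings *)

Section Submodule.
Variables (A : pzRingType) (V : lmodType A) (P : {pred V}).

(** The closure proof is an argument so that the instances below, which need it,
can be found from the term. *)
Definition submod_pred (clP : submod_closed P) : {pred V} := P.

Variable clP : submod_closed P.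
HB.instance Definition _ :=
  GRing.isSubmodClosed.Build A V (submod_pred clP) clP.

Record submod : Type := Submod { submod_val : V; _ : submod_val \in submod_pred clP }.
HB.instance Definition _ := [isSub for submod_val].
HB.instance Definition _ := [Choice of submod by <:].
HB.instance Definition _ := [SubChoice_isSubLmodule of submod by <:].

Lemma submod_in (x : submod) : val x \in P. Proof. exact: (valP x). Qed.

End Submodule.

Section Descent.
Variables (A B : pzRingType) (w : {rmorphism A -> B}) (w_surj : surj w).
Variables (V : lmodType A) (killV : forall a (x : V), w a = 0 -> a *: x = 0).

(** Both proofs are arguments because the scaling defined below depends on them:
an element of [B] acts through any of its lifts to [A]. *)
Definition descent of surj w & (forall a (x : V), w a = 0 -> a *: x = 0) : Type := V.
Local Notation L := (descent w_surj killV).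
HB.instance Definition _ := GRing.Zmodule.copy L V.

Definition descent_scale (b : B) (x : L) : L := sval (cid (w_surj b)) *: (x : V).

Lemma descent_scale_lift a (x : L) : descent_scale (w a) x = a *: (x : V).
Proof.
rewrite /descent_scale; case: cid => a' /= eq_w.
by apply/eqP; rewrite -subr_eq0 -scalerBl killV // rmorphB eq_w subrr.
Qed.

Lemma descent_scaleA a b x :
  descent_scale a (descent_scale b x) = descent_scale (a * b) x.
Proof.
have [a' <-] := w_surj a; have [b' <-] := w_surj b.
by rewrite -rmorphM !descent_scale_lift scalerA.
Qed.

Lemma descent_scale1 : left_id 1 descent_scale.
Proof. by move=> x; rewrite -(rmorph1 w) descent_scale_lift scale1r. Qed.

Lemma descent_scaleDr : right_distributive descent_scale +%R.
Proof. by move=> b x y; apply: scalerDr. Qed.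

Lemma descent_scaleDl x : {morph descent_scale^~ x : a b / a + b}.
Proof.
move=> a b /=; have [a' <-] := w_surj a; have [b' <-] := w_surj b.
by rewrite -rmorphD !descent_scale_lift scalerDl.
Qed.

HB.instance Definition _ := GRing.Zmodule_isLmodule.Build B L
  descent_scaleA descent_scale1 descent_scaleDr descent_scaleDl.

Lemma descent_scaleE a (x : L) : w a *: x = a *: (x : V) :> V.
Proof. exact: descent_scale_lift. Qed.

End Descent.

Section CokerPi.
Variables (A : pzRingType) (U V : lmodType A) (f : {linear U -> V}).

Definition coker_pi (x : V) : coker f := \pi_(coker f) x.

Lemma coker_pi_linear : linear coker_pi.
Proof.
move=> a x y; rewrite /coker_pi coker_pi_add; congr (_ + _).
exact/esym/coker_pi_scale.
Qed.
HB.instance Definition _ :=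
  GRing.isLinear.Build A V (coker f) *:%R coker_pi coker_pi_linear.

Lemma coker_piP x y : coker_pi x = coker_pi y <-> exists u, f u = x - y.
Proof. by split=> [/eqP/coker_eqP|/coker_eqP/eqP]. Qed.

Lemma coker_pi_surj : surj coker_pi.
Proof. by move=> q; exists (repr q); apply: reprK. Qed.

End CokerPi.

Lemma factor_surj (A : pzRingType) (U V W : lmodType A)
    (h : {linear U -> V}) (e : {linear U -> W}) :
  surj h -> (forall x, h x = 0 -> e x = 0) ->
  exists e' : {linear V -> W}, forall x, e' (h x) = e x.
Proof.
move=> h_surj kerh; have [s hs] := choice h_surj.
have eE x : e (s (h x)) = e x.
  by apply: subr0_eq; rewrite -linearB; apply: kerh; rewrite linearB hs subrr.
have e'_linear : linear (e \o s).
  move=> a x y; rewrite /= -[in LHS](hs x) -[in LHS](hs y) -linearP eE.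
  exact: linearP.
pose e'_mixin := GRing.isLinear.Build A V W *:%R (e \o s) e'_linear.
pose e' : {linear V -> W} := HB.pack (e \o s) e'_mixin.
by exists e'.
Qed.

Lemma inj_surj_bij (A B : Type) (f : A -> B) : injective f -> surj f -> bijective f.
Proof.
move=> f_inj /choice[g fg]; exists g => // x.
by apply: f_inj; rewrite fg.
Qed.

(** * The two legs of a separated diagram *)

Section Leg.
Variables (A B : pzRingType) (v : {rmorphism A -> B}).

Lemma ker_smul_map (V W : lmodType A) (h : {linear V -> W}) x :
  ker_smul v x -> ker_smul v (h x).
Proof.
move=> [n [a [y [va ->]]]]; exists n, a, (h \o y); split=> //.
by rewrite linear_sum; apply: eq_bigr => i _; rewrite linearZ.
Qed.

Lemma ker_smul_eq0 (V : lmodType A) (W : lmodType B)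
    (p : {linear V -> W | v \; *:%R}) x : ker_smul v x -> p x = 0.
Proof.
move=> [n [a [y [va ->]]]]; rewrite linear_sum big1 // => i _.
by rewrite linearZ /= va scale0r.
Qed.

(** Being separated is a condition on each of the two maps of a diagram, so the
constructions below are done for one map at a time. *)
Definition separated_leg (V : lmodType A) (W : lmodType B)
    (p : {linear V -> W | v \; *:%R}) : Prop :=
  surj p /\ forall x, p x = 0 <-> ker_smul v x.

Section Quotient.
Variables (V : lmodType A) (W : lmodType B) (p : {linear V -> W | v \; *:%R}).
Variables (N : {pred V}) (clN : submod_closed N).
Hypothesis pN : forall x, x \in N -> p x = 0.

Definition sub_inj : submod clN -> V := val.
HB.instance Definition _ := GRing.Linear.on sub_inj.

Definition quot : lmodType A := coker sub_inj.
Definition quot_pi : {linear V -> quot} := coker_pi sub_inj.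

Lemma quot_piP x y : quot_pi x = quot_pi y <-> x - y \in N.
Proof.
split=> [/coker_piP[u <-]|Nxy]; first exact: submod_in.
by apply/coker_piP; exists (Submod (Nxy : x - y \in submod_pred clN)).
Qed.

Lemma quot_pi_eq0 x : quot_pi x = 0 <-> x \in N.
Proof. by rewrite -(linear0 quot_pi) quot_piP subr0. Qed.

Definition quot_repr (q : quot) : V := repr (q : coker sub_inj).

Lemma quot_reprK q : quot_pi (quot_repr q) = q. Proof. exact: reprK. Qed.

(** The hypothesis that [p] kills [N] is an argument because linearity, declared
below, depends on it. *)
Definition quot_map of (forall x, x \in N -> p x = 0) : quot -> W :=
  fun q => p (quot_repr q).

Lemma quot_map_pi x : quot_map pN (quot_pi x) = p x.
Proof.
rewrite /quot_map; apply: subr0_eq; rewrite -raddfB; apply: pN.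
by apply/quot_piP; rewrite quot_reprK.
Qed.

Lemma quot_map_linear : linear_for (v \; *:%R) (quot_map pN).
Proof.
move=> a x y; rewrite -[x]quot_reprK -[y]quot_reprK.
by rewrite -(linearP quot_pi) !quot_map_pi linearP.
Qed.
HB.instance Definition _ :=
  GRing.isLinear.Build A quot W (v \; *:%R) (quot_map pN) quot_map_linear.

Lemma quot_separated : separated_leg p -> separated_leg (quot_map pN).
Proof.
move=> [p_surj kerp]; split=> [y|q].
  by have [x <-] := p_surj y; exists (quot_pi x); apply: quot_map_pi.
split; last exact: ker_smul_eq0.
rewrite -[q]quot_reprK [GRing.Linear.sort _ _]quot_map_pi => /kerp.
exact: ker_smul_map.
Qed.

End Quotient.

Section Preimage.
Variables (V : lmodType A) (W : lmodType B) (p : {linear V -> W | v \; *:%R}).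
Variables (D : {pred W}) (clD : submod_closed D).

Definition preim_pred : {pred V} := fun x => p x \in D.

Lemma preim_closed : submod_closed preim_pred.
Proof.
have [D0 DP] := clD; split; first by rewrite unfold_in /= raddf0.
by move=> a x y Dx Dy; rewrite unfold_in /= linearP; apply: DP.
Qed.

Definition preim : lmodType A := submod preim_closed.
Definition preim_inj : preim -> V := val.
HB.instance Definition _ := GRing.Linear.on preim_inj.

Definition preim_map (x : preim) : submod clD :=
  Submod (submod_in x : p (val x) \in submod_pred clD).

Lemma preim_map_linear : linear_for (v \; *:%R) preim_map.
Proof. by move=> a x y; apply: val_inj; rewrite /= linearP. Qed.
HB.instance Definition _ :=
  GRing.isLinear.Build A preim (submod clD) (v \; *:%R) preim_map preim_map_linear.

(** An element of the kernel of [p] is a sum of products [a_i y_i] with [v a_i = 0];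
moving each [y_i] into the preimage of [D] by subtracting an element killed by
[ker v] does not change these products. *)
Lemma preim_separated : separated_leg p ->
  (forall x, exists2 n, p (x - n) \in D & forall a, v a = 0 -> a *: n = 0) ->
  separated_leg preim_map.
Proof.
move=> [p_surj kerp] split_x; split=> [y|x].
  have [x px] := p_surj (val y).
  have Dx : x \in submod_pred preim_closed by rewrite unfold_in /= px submod_in.
  by exists (Submod Dx); apply: val_inj.
split; last exact: ker_smul_eq0.
move=> /(congr1 val)/= /kerp[n [a [y [va xE]]]].
have /choice[z zP] i : exists z : preim, a i *: val z = a i *: y i.
  have [m Dm am] := split_x (y i).
  exists (Submod (Dm : y i - m \in submod_pred preim_closed)).
  by rewrite /= scalerBr am ?subr0.
exists n, a, z; split=> //; apply: val_inj.
rewrite [LHS]xE (raddf_sum (@preim_inj)); apply: eq_bigr => i _.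
by rewrite -zP.
Qed.

End Preimage.
End Leg.

(** * Free modules *)

Section Free.
Variable T : choiceType.

Section Base.
Variable A : pzRingType.

Definition fin_supp_pred : {pred T -> A^o} :=
  fun f => `[< exists s : seq T, forall t, t \notin s -> f t = 0 >].

Lemma fin_suppP f :
  reflect (exists s : seq T, forall t, t \notin s -> f t = 0) (f \in fin_supp_pred).
Proof. exact: asboolP. Qed.

Lemma fin_supp_closed : submod_closed fin_supp_pred.
Proof.
split; first by apply/fin_suppP; exists [::].
move=> a f g /fin_suppP[s sf] /fin_suppP[r rg]; apply/fin_suppP.
exists (s ++ r) => t; rewrite mem_cat negb_or => /andP[/sf ft /rg gt].
by rewrite -[LHS]/(a *: f t + g t) ft gt scaler0 addr0.
Qed.

Definition free : lmodType A := submod fin_supp_closed.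
Definition coef (x : free) (t : T) : A := val x t.

Lemma coef0 t : coef 0 t = 0.
Proof. by []. Qed.

Lemma coefD (x y : free) t : coef (x + y) t = coef x t + coef y t.
Proof. by []. Qed.

Lemma coefZ a (x : free) t : coef (a *: x) t = a * coef x t.
Proof. by []. Qed.

Lemma coef_supp (x : free) :
  exists2 s : seq T, uniq s & forall t, t \notin s -> coef x t = 0.
Proof.
have /fin_suppP[s s0] := submod_in x; exists (undup s); rewrite ?undup_uniq //.
by move=> t; rewrite mem_undup; apply: s0.
Qed.

Lemma coef_inj (x y : free) : coef x =1 coef y -> x = y.
Proof. by move=> eq_xy; apply/val_inj/funext. Qed.

Lemma free_ofP (f : T -> A) (s : seq T) : (forall t, t \notin s -> f t = 0) ->
  (f : T -> A^o) \in submod_pred fin_supp_closed.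
Proof. by move=> s0; apply/fin_suppP; exists s. Qed.

Definition free_of f s (s0 : forall t, t \notin s -> f t = 0) : free :=
  Submod (free_ofP s0).

Lemma basis_subproof (t u : T) : u \notin [:: t] -> (u == t)%:R = 0 :> A.
Proof. by rewrite inE => /negbTE->. Qed.
Definition basis t : free := free_of (@basis_subproof t).

Lemma coef_basis t u : coef (basis t) u = (u == t)%:R.
Proof. by []. Qed.

Lemma free_sum (x : free) (s : seq T) : uniq s ->
  (forall t, t \notin s -> coef x t = 0) -> x = \sum_(t <- s) coef x t *: basis t.
Proof.
move=> s_uniq s0; apply: coef_inj => u.
rewrite (big_morph (coef^~ u) (fun x y => coefD x y u) (coef0 u)).
have [su|/[dup] su /s0->] := boolP (u \in s).
  rewrite (bigD1_seq u) //= big1 ?addr0 => [|t tu].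
    by rewrite coefZ coef_basis eqxx mulr1.
  by rewrite coefZ coef_basis eq_sym (negbTE tu) mulr0.
rewrite big_seq big1 // => t st; rewrite coefZ coef_basis.
by rewrite (negbTE (_ : u != t)) ?mulr0 //; apply: contraNneq su => ->.
Qed.

End Base.

Section Map.
Variables (A B : pzRingType) (v : {rmorphism A -> B}).

Lemma free_map_subproof (x : free A) :
  ((fun t => v (coef x t)) : T -> B^o) \in submod_pred (@fin_supp_closed B).
Proof.
have [s _ s0] := coef_supp x.
by apply: (free_ofP (s := s)) => t /s0->; rewrite rmorph0.
Qed.
Definition free_map (x : free A) : free B := Submod (free_map_subproof x).

Lemma coef_map x t : coef (free_map x) t = v (coef x t).
Proof. by []. Qed.

Lemma free_map_linear : linear_for (v \; *:%R) free_map.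
Proof.
move=> a x y; apply: coef_inj => t.
by rewrite coef_map coefD [coef (a *: x) t]coefZ rmorphD rmorphM.
Qed.
HB.instance Definition _ :=
  GRing.isLinear.Build A (free A) (free B) (v \; *:%R) free_map free_map_linear.

(** The kernel consists of the combinations of the basis with coefficients in
[ker v]. *)
Lemma free_map_separated : surj v -> separated_leg free_map.
Proof.
move=> v_surj; split=> [y|x].
  have [s _ s0] := coef_supp y.
  have lift0 t : t \notin s ->
      (if t \in s then sval (cid (v_surj (coef y t))) else 0) = 0 by move/negbTE->.
  exists (free_of lift0); apply: coef_inj => t.
  rewrite [LHS]/(v (if _ then _ else _)).
  case: ifPn => [_|/s0->]; last exact: rmorph0.
  exact: svalP (cid (v_surj (coef y t))).
split; last exact: ker_smul_eq0.
move=> vx0; have [s s_uniq s0] := coef_supp x.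
exists (size s), (fun i => coef x (tnth (in_tuple s) i)).
exists (fun i => basis A (tnth (in_tuple s) i)); split=> [i|].
  by rewrite -coef_map vx0 coef0.
by rewrite -(big_tnth _ _ s xpredT (fun t => coef x t *: basis A t)) -free_sum.
Qed.

End Map.
End Free.

(** * Separated covers by free modules *)

Section Presentation.
Variables (R1 R2 Rbar : pzRingType).
Variables (v1 : {rmorphism R1 -> Rbar}) (v2 : {rmorphism R2 -> Rbar}).
Hypotheses (v1_surj : surj v1) (v2_surj : surj v2).
Local Notation pbring := (pbring v1 v2).
Local Notation pbdiag := (pbdiag v1 v2).

Lemma separated_legs (S : pbdiag) :
  separated S <-> separated_leg (pbp1 S) /\ separated_leg (pbp2 S).
Proof. by split=> [[]|[[? ?] []]]. Qed.

Definition pb_pair (S : pbdiag) x1 x2 (eq_p : pbp1 S x1 = pbp2 S x2) : pbmod S :=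
  PbMod (introT eqP eq_p : (x1, x2) \in @pbmod_pred _ _ _ _ _ S).

Lemma pbmod_eq (S : pbdiag) (x : pbmod S) : pbp1 S (val x).1 = pbp2 S (val x).2.
Proof. exact/eqP/(valP x). Qed.

Definition pbring_pair r1 r2 (eq_v : v1 r1 = v2 r2) : pbring :=
  PbRing (introT eqP eq_v : (r1, r2) \in pbring_pred v1 v2).

Lemma pbring_eq (r s : pbring) :
  (val r).1 = (val s).1 -> (val r).2 = (val s).2 -> r = s.
Proof.
move=> eq1 eq2; apply: val_inj.
by case: (val r) (val s) eq1 eq2 => ? ? [? ?] /= -> ->.
Qed.

Lemma pbring_linear1 (a r s : pbring) :
  (val (a * r + s)).1 = (val a).1 * (val r).1 + (val s).1.
Proof. by []. Qed.

Lemma pbring_linear2 (a r s : pbring) :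
  (val (a * r + s)).2 = (val a).2 * (val r).2 + (val s).2.
Proof. by []. Qed.

Section PbmodLinear.
Variables (S : pbdiag) (a : pbring) (x y : pbmod S).

Lemma pbmod_linear1 :
  (val (a *: x + y)).1 = (val a).1 *: (val x).1 + (val y).1.
Proof. by []. Qed.

Lemma pbmod_linear2 :
  (val (a *: x + y)).2 = (val a).2 *: (val x).2 + (val y).2.
Proof. by []. Qed.

End PbmodLinear.

Lemma pbmod_inj (S : pbdiag) (x y : pbmod S) :
  (val x).1 = (val y).1 -> (val x).2 = (val y).2 -> x = y.
Proof.
move=> eq1 eq2; apply: val_inj.
by case: (val x) (val y) eq1 eq2 => ? ? [? ?] /= -> ->.
Qed.

Lemma pbring_lift1 a : exists r : pbring, (val r).1 = a.
Proof. by have [b vb] := v2_surj (v1 a); exists (pbring_pair (esym vb)). Qed.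

Lemma pbring_lift2 b : exists r : pbring, (val r).2 = b.
Proof. by have [a va] := v1_surj (v2 b); exists (pbring_pair va). Qed.

Variable M : lmodType pbring.

Section FreeCover.

Definition free_diag : pbdiag :=
  PbDiag (@free_map M _ _ v1) (@free_map M _ _ v2).

Lemma free_coef_ex (x : pbmod free_diag) (m : M) :
  {r : pbring | (val r).1 = coef (val x).1 m & (val r).2 = coef (val x).2 m}.
Proof.
have eq_x : v1 (coef (val x).1 m) = v2 (coef (val x).2 m).
  by have := congr1 (fun y : free M Rbar => coef y m) (pbmod_eq x).
by exists (pbring_pair eq_x).
Qed.
(** The coefficient is hidden behind an opaque proof to keep unification from
unfolding the arithmetic of the pullback ring. *)
Definition free_coef x m : pbring := s2val (free_coef_ex x m).

Lemma free_coef1 x m : (val (free_coef x m)).1 = coef (val x).1 m.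
Proof. by rewrite /free_coef; case: free_coef_ex. Qed.

Lemma free_coef2 x m : (val (free_coef x m)).2 = coef (val x).2 m.
Proof. by rewrite /free_coef; case: free_coef_ex. Qed.

Definition free_eval (x : pbmod free_diag) : M :=
  \sum_(m \in [set: M]%classic) free_coef x m *: m.

Lemma free_evalE x (s : seq M) : uniq s ->
  (forall m, m \notin s -> free_coef x m = 0) ->
  free_eval x = \sum_(m <- s) free_coef x m *: m.
Proof.
move=> s_uniq s0; rewrite /free_eval -set_true -(@bigfs _ _ _ _ s) //.
by move=> m _ /s0->; rewrite scale0r.
Qed.

Lemma free_coef_supp (x : pbmod free_diag) :
  exists s : seq M, forall m, m \notin s -> free_coef x m = 0.
Proof.
have [s _ s0] := coef_supp (val x).1; have [r _ r0] := coef_supp (val x).2.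
exists (s ++ r) => m; rewrite mem_cat negb_or => /andP[/s0 x1 /r0 x2].
by apply: pbring_eq; rewrite ?free_coef1 ?free_coef2.
Qed.

Lemma free_eval_linear : linear free_eval.
Proof.
move=> a x y; have [s s0] := free_coef_supp x; have [r r0] := free_coef_supp y.
have free_coefD m : free_coef (a *: x + y) m = a * free_coef x m + free_coef y m.
  apply: pbring_eq.
    by rewrite pbring_linear1 !free_coef1 pbmod_linear1 coefD coefZ.
  by rewrite pbring_linear2 !free_coef2 pbmod_linear2 coefD coefZ.
have t0 m : m \notin undup (s ++ r) -> free_coef x m = 0 /\ free_coef y m = 0.
  by rewrite mem_undup mem_cat negb_or => /andP[/s0 ? /r0].
rewrite !(@free_evalE _ (undup (s ++ r))) ?undup_uniq //; first last.
- by move=> m /t0[x0 y0]; rewrite free_coefD x0 y0 mulr0 addr0.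
- by move=> m /t0[].
- by move=> m /t0[].
rewrite scaler_sumr -big_split; apply: eq_bigr => m _.
by rewrite free_coefD scalerDl scalerA.
Qed.
HB.instance Definition _ :=
  GRing.isLinear.Build pbring (pbmod free_diag) M *:%R free_eval free_eval_linear.

Lemma free_eval_surj : surj free_eval.
Proof.
move=> m.
have eq_b : pbp1 free_diag (basis R1 m) = pbp2 free_diag (basis R2 m).
  by apply: coef_inj => t; rewrite /= !coef_map !coef_basis !rmorph_nat.
have coef_b t : free_coef (pb_pair eq_b) t = (t == m)%:R.
  by apply: pbring_eq; rewrite ?free_coef1 ?free_coef2 coef_basis; case: (t == m).
exists (pb_pair eq_b); rewrite (@free_evalE _ [:: m]) //.
  by rewrite big_seq1 coef_b eqxx scale1r.
by move=> t; rewrite inE coef_b => /negbTE->.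
Qed.

End FreeCover.

(** The free modules on the set [M] over the three rings form a separated diagram,
whose pullback is the free module on [M] over the pullback ring. *)
Lemma separated_cover :
  exists (S : pbdiag) (e : {linear pbmod S -> M}), separated S /\ surj e.
Proof.
exists free_diag, free_eval; split.
  by apply/separated_legs; split; apply: free_map_separated.
exact: free_eval_surj.
Qed.

(** * Dividing out the kernel on each leg *)

Section ReduceKernel.
Variables (S : pbdiag) (e : {linear pbmod S -> M}).

(** For separated [S], the intersection of the kernel with [P_1 S], read in the
first component. *)
Definition ker1_pred : {pred pb1 S} :=
  fun x => `[< exists n : pbmod S, [/\ e n = 0, (val n).1 = x & (val n).2 = 0] >].

Definition ker2_pred : {pred pb2 S} :=
  fun x => `[< exists n : pbmod S, [/\ e n = 0, (val n).1 = 0 & (val n).2 = x] >].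

Lemma ker1P x : reflect (exists n : pbmod S, [/\ e n = 0, (val n).1 = x & (val n).2 = 0])
  (x \in ker1_pred).
Proof. exact: asboolP. Qed.

Lemma ker2P x : reflect (exists n : pbmod S, [/\ e n = 0, (val n).1 = 0 & (val n).2 = x])
  (x \in ker2_pred).
Proof. exact: asboolP. Qed.

Lemma ker1_closed : submod_closed ker1_pred.
Proof.
split; first by apply/ker1P; exists 0; rewrite linear0.
move=> a x y /ker1P[n [en <- n2]] /ker1P[m [em <- m2]]; apply/ker1P.
have [r <-] := pbring_lift1 a; exists (r *: n + m).
by rewrite linearP en em scaler0 addr0 pbmod_linear1 pbmod_linear2 n2 m2 scaler0 addr0.
Qed.

Lemma ker2_closed : submod_closed ker2_pred.
Proof.
split; first by apply/ker2P; exists 0; rewrite linear0.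
move=> a x y /ker2P[n [en n1 <-]] /ker2P[m [em m1 <-]]; apply/ker2P.
have [r <-] := pbring_lift2 a; exists (r *: n + m).
by rewrite linearP en em scaler0 addr0 pbmod_linear1 pbmod_linear2 n1 m1 scaler0 addr0.
Qed.

Lemma ker1_eq0 x : x \in ker1_pred -> pbp1 S x = 0.
Proof. by case/ker1P=> n [_ <- n2]; rewrite pbmod_eq n2 linear0. Qed.

Lemma ker2_eq0 x : x \in ker2_pred -> pbp2 S x = 0.
Proof. by case/ker2P=> n [_ n1 <-]; rewrite -pbmod_eq n1 linear0. Qed.

Definition reduced_diag : pbdiag :=
  PbDiag (quot_map (clN := ker1_closed) ker1_eq0)
         (quot_map (clN := ker2_closed) ker2_eq0).

Lemma reduced_proj_subproof (x : pbmod S) :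
  pbp1 reduced_diag (quot_pi ker1_closed (val x).1) =
  pbp2 reduced_diag (quot_pi ker2_closed (val x).2).
Proof. by rewrite /= !quot_map_pi pbmod_eq. Qed.
Definition reduced_proj x : pbmod reduced_diag := pb_pair (reduced_proj_subproof x).

Lemma reduced_proj_linear : linear reduced_proj.
Proof.
by move=> a x y; apply: pbmod_inj; rewrite ?pbmod_linear1 ?pbmod_linear2 /=
  ?pbmod_linear1 ?pbmod_linear2 linearP.
Qed.
HB.instance Definition _ :=
  GRing.isLinear.Build pbring (pbmod S) (pbmod reduced_diag) *:%R reduced_proj
    reduced_proj_linear.

Lemma reduced_proj_surj : surj reduced_proj.
Proof.
move=> q; have := pbmod_eq q; rewrite -[(val q).1]quot_reprK -[(val q).2]quot_reprK.
rewrite /= !quot_map_pi => eq_p; exists (pb_pair eq_p).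
by apply: pbmod_inj; rewrite /= quot_reprK.
Qed.

Lemma reduced_proj_ker x : reduced_proj x = 0 -> e x = 0.
Proof.
move=> x0; have := congr1 (fun q => (val q).1) x0.
have := congr1 (fun q => (val q).2) x0.
move=> /quot_pi_eq0/ker2P[n [en n1 n2]] /quot_pi_eq0/ker1P[m [em m1 m2]].
suff -> : x = m + n by rewrite linearD em en addr0.
by apply: pbmod_inj; rewrite /= ?m1 ?n1 ?m2 ?n2 ?addr0 ?add0r.
Qed.

End ReduceKernel.

(** For separated [S], this says that the kernel of [e] meets [P_1 S] and [P_2 S]
in zero, since the elements of [P_1 S] are those with second component zero. *)
Definition kernel_reduced (S : pbdiag) (e : {linear pbmod S -> M}) : Prop :=
  forall n : pbmod S, e n = 0 -> (val n).1 = 0 <-> (val n).2 = 0.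

(** If [(x1, x2)] lies in the kernel and [x1] becomes zero in the quotient, then
[(x1, 0)] lies in the kernel, hence so does [(0, x2)], and [x2] becomes zero
as well. *)
Lemma reduced_cover (S : pbdiag) (e : {linear pbmod S -> M}) :
  separated S -> surj e ->
  exists (S' : pbdiag) (e' : {linear pbmod S' -> M}),
    [/\ separated S', surj e' & kernel_reduced e'].
Proof.
move=> /separated_legs[sep1 sep2] e_surj.
have [e' e'E] := factor_surj (reduced_proj_surj (e := e)) (@reduced_proj_ker _ e).
exists (reduced_diag e), e'; split.
- by apply/separated_legs; split; apply: quot_separated.
- by move=> m; have [x <-] := e_surj m; exists (reduced_proj e x); apply: e'E.
move=> q; have [x <-] := reduced_proj_surj q; rewrite e'E => ex.
split.
- move=> /quot_pi_eq0/ker1P[m [em m1 m2]].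
  apply/quot_pi_eq0/ker2P; exists (x - m).
  by rewrite linearB ex em subrr /= m1 m2 subrr subr0.
- move=> /quot_pi_eq0/ker2P[m [em m1 m2]].
  apply/quot_pi_eq0/ker1P; exists (x - m).
  by rewrite linearB ex em subrr /= m1 m2 subrr subr0.
Qed.

Section KilledKernel.
Variables (S : pbdiag) (e : {linear pbmod S -> M}).
Hypothesis e_red : kernel_reduced e.

(** The element [(a, 0)] of the pullback ring sends [n] to a kernel element whose
second component is zero. *)
Lemma ker_kill1 n : e n = 0 -> forall a, v1 a = 0 -> a *: (val n).1 = 0.
Proof.
move=> en a va.
have eq_v : v1 a = v2 0 by rewrite va rmorph0.
have := e_red (n := pbring_pair eq_v *: n); rewrite linearZ /= en scaler0.
by move=> /(_ erefl)[_]; apply; rewrite scale0r.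
Qed.

Lemma ker_kill2 n : e n = 0 -> forall b, v2 b = 0 -> b *: (val n).2 = 0.
Proof.
move=> en b vb.
have eq_v : v1 0 = v2 b by rewrite vb rmorph0.
have := e_red (n := pbring_pair eq_v *: n); rewrite linearZ /= en scaler0.
by move=> /(_ erefl)[+ _]; apply; rewrite scale0r.
Qed.

End KilledKernel.

(** * Shrinking the kernel *)

Section Shrink.
Variable S : pbdiag.
Variables (D : {pred pbbar S}) (clD : submod_closed D).

Definition preim_diag : pbdiag :=
  PbDiag (preim_map (p := pbp1 S) (clD := clD))
         (preim_map (p := pbp2 S) (clD := clD)).

Lemma preim_incl_subproof (x : pbmod preim_diag) :
  pbp1 S (val (val x).1) = pbp2 S (val (val x).2).
Proof. exact: (congr1 (fun y : submod clD => val y) (pbmod_eq x)). Qed.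
Definition preim_incl x : pbmod S := pb_pair (preim_incl_subproof x).

Lemma preim_incl_linear : linear preim_incl.
Proof. by move=> a x y; apply: pbmod_inj. Qed.
HB.instance Definition _ :=
  GRing.isLinear.Build pbring (pbmod preim_diag) (pbmod S) *:%R preim_incl
    preim_incl_linear.

Lemma preim_incl_in x : pbp1 S (val (preim_incl x)).1 \in D.
Proof. exact: (submod_in (val x).1). Qed.

Lemma preim_inclP x : pbp1 S (val x).1 \in D -> exists y, preim_incl y = x.
Proof.
move=> D1; have D2 : pbp2 S (val x).2 \in D by rewrite -pbmod_eq.
pose x1 : pb1 preim_diag :=
  Submod (D1 : (val x).1 \in submod_pred (preim_closed (pbp1 S) clD)).
pose x2 : pb2 preim_diag :=
  Submod (D2 : (val x).2 \in submod_pred (preim_closed (pbp2 S) clD)).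
have eq_x : pbp1 preim_diag x1 = pbp2 preim_diag x2.
  by apply: val_inj; rewrite /= pbmod_eq.
by exists (pb_pair eq_x); apply: pbmod_inj.
Qed.

End Shrink.

(** Restricting to the preimage of a complement of the image of the kernel in
[Sbar] loses nothing of [M] and forces the remaining kernel to map to zero. *)
Lemma small_kernel_cover (S : pbdiag) (e : {linear pbmod S -> M}) :
  semisimple_ring Rbar -> separated S -> surj e -> kernel_reduced e ->
  exists (S' : pbdiag) (e' : {linear pbmod S' -> M}),
    [/\ separated S', surj e', kernel_reduced e'
      & forall n, e' n = 0 -> pbp1 S' (val n).1 = 0].
Proof.
move=> ss /separated_legs[sep1 sep2] e_surj e_red.
pose N : {pred pbbar S} := fun y =>
  `[< exists2 n : pbmod S, e n = 0 & pbp1 S (val n).1 = y >].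
have NP y : reflect (exists2 n : pbmod S, e n = 0 & pbp1 S (val n).1 = y) (y \in N).
  exact: asboolP.
have clN : submod_closed N.
  split; first by apply/NP; exists 0; rewrite ?linear0.
  move=> c _ _ /NP[n en <-] /NP[m em <-]; apply/NP.
  have [a <-] := v1_surj c; have [r <-] := pbring_lift1 a.
  exists (r *: n + m); first by rewrite linearP en em scaler0 addr0.
  by rewrite pbmod_linear1 linearP.
have [D [clD ND VND]] := semisimple_complement ss clN.
exists (preim_diag clD), (e \o preim_incl (clD := clD)); split.
- apply/separated_legs; split; apply: preim_separated => // x.
    have [y /NP[n en <-] Dx] := VND (pbp1 S x).
    by exists (val n).1; [rewrite linearB | apply: ker_kill1 en].
  have [y /NP[n en <-] Dx] := VND (pbp2 S x).
  by exists (val n).2; [rewrite linearB -pbmod_eq | apply: ker_kill2 en].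
- move=> m; have [x <-] := e_surj m.
  have [y /NP[n en <-] Dx] := VND (pbp1 S (val x).1).
  have [z zE] : exists z, preim_incl (clD := clD) z = x - n.
    by apply: preim_inclP; rewrite /= linearB.
  by exists z; rewrite /= zE linearB en subr0.
- move=> n en; have [red1 red2] := e_red _ en; split.
    by move=> n1; apply: val_inj; apply: red1; rewrite /= n1.
  by move=> n2; apply: val_inj; apply: red2; rewrite /= n2.
- move=> n en; apply: val_inj; apply: ND; last exact: preim_incl_in n.
  by apply/NP; exists (preim_incl n).
Qed.

(** * The presentation carried by a reduced kernel *)

Section KernelPresentation.
Variables (S : pbdiag) (e : {linear pbmod S -> M}).
Hypotheses (e_red : kernel_reduced e)
  (e_small : forall n, e n = 0 -> pbp1 S (val n).1 = 0).

Definition ker_pred : {pred pbmod S} := fun n => e n == 0.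

Lemma ker_closed : submod_closed ker_pred.
Proof.
split; first by rewrite unfold_in /= linear0.
by move=> r n m /eqP en /eqP em; rewrite unfold_in /= linearP en em scaler0 addr0.
Qed.

Lemma ker_eq0 (n : submod ker_closed) : e (val n) = 0.
Proof. exact/eqP/(submod_in n). Qed.

Definition pbring_bar (r : pbring) : Rbar := v1 (val r).1.
Lemma pbring_bar_zmod : zmod_morphism pbring_bar.
Proof. by move=> r s; rewrite /pbring_bar -rmorphB. Qed.
Lemma pbring_bar_monoid : monoid_morphism pbring_bar.
Proof. by split=> [|r s]; rewrite /pbring_bar -?rmorphM // -(rmorph1 v1). Qed.
HB.instance Definition _ :=
  GRing.isZmodMorphism.Build pbring Rbar pbring_bar pbring_bar_zmod.
HB.instance Definition _ :=
  GRing.isMonoidMorphism.Build pbring Rbar pbring_bar pbring_bar_monoid.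

Lemma pbring_bar2 (r : pbring) : pbring_bar r = v2 (val r).2.
Proof. exact/eqP/(valP r). Qed.

Lemma pbring_bar_surj : surj pbring_bar.
Proof.
by move=> c; have [a <-] := v1_surj c; have [r <-] := pbring_lift1 a; exists r.
Qed.

Lemma ker_killed r (n : submod ker_closed) : pbring_bar r = 0 -> r *: n = 0.
Proof.
move=> r0; apply: val_inj; apply: pbmod_inj.
  exact: (ker_kill1 e_red (ker_eq0 n) r0).
by apply: (ker_kill2 e_red (ker_eq0 n)); rewrite -pbring_bar2.
Qed.

(** As [P_1] and [P_2] kill the kernel, the action of [R] on it factors through
[Rbar]; this is the module [K] of the presentation. *)
Definition kerL : lmodType Rbar := descent pbring_bar_surj ker_killed.
Definition kerL_val (n : kerL) : pbmod S := val (n : submod ker_closed).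

Lemma kerL_val_linear r (n m : kerL) :
  kerL_val (pbring_bar r *: n + m) = r *: kerL_val n + kerL_val m.
Proof.
have -> : pbring_bar r *: n = r *: (n : submod ker_closed) :> kerL.
  exact: (descent_scaleE (w := pbring_bar)).
by [].
Qed.

Definition ker_f1 (n : restr v1 kerL) : pb1 S := (val (kerL_val n)).1.
Definition ker_f2 (n : restr v2 kerL) : pb2 S := (val (kerL_val n)).2.

Lemma ker_f1_linear : linear ker_f1.
Proof.
move=> a n m; have [r <-] := pbring_lift1 a.
rewrite -[LHS]/(val (kerL_val (pbring_bar r *: (n : kerL) + m))).1.
by rewrite kerL_val_linear pbmod_linear1.
Qed.
HB.instance Definition _ :=
  GRing.isLinear.Build R1 (restr v1 kerL) (pb1 S) *:%R ker_f1 ker_f1_linear.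

Lemma ker_f2_linear : linear ker_f2.
Proof.
move=> a n m; have [r <-] := pbring_lift2 a.
rewrite -[LHS]/(val (kerL_val (v2 (val r).2 *: (n : kerL) + m))).2.
by rewrite -pbring_bar2 kerL_val_linear pbmod_linear2.
Qed.
HB.instance Definition _ :=
  GRing.isLinear.Build R2 (restr v2 kerL) (pb2 S) *:%R ker_f2 ker_f2_linear.

Lemma ker_f1_inj : injective ker_f1.
Proof.
move=> n m eq_nm; suff: kerL_val n - kerL_val m = 0 by move/subr0_eq/val_inj.
have e0 : e (kerL_val n - kerL_val m) = 0 by rewrite linearB !ker_eq0 subrr.
have n1 : (val (kerL_val n - kerL_val m)).1 = 0.
  by apply/eqP; rewrite [_.1]/(ker_f1 n - ker_f1 m) subr_eq0 eq_nm.
by apply: pbmod_inj; rewrite ?n1 ?((e_red e0).1 n1).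
Qed.

Lemma ker_f2_inj : injective ker_f2.
Proof.
move=> n m eq_nm; suff: kerL_val n - kerL_val m = 0 by move/subr0_eq/val_inj.
have e0 : e (kerL_val n - kerL_val m) = 0 by rewrite linearB !ker_eq0 subrr.
have n2 : (val (kerL_val n - kerL_val m)).2 = 0.
  by apply/eqP; rewrite [_.2]/(ker_f2 n - ker_f2 m) subr_eq0 eq_nm.
by apply: pbmod_inj; rewrite ?n2 ?((e_red e0).2 n2).
Qed.

Lemma ker_f1_bar (n : restr v1 kerL) : pbp1 S (ker_f1 n) = 0.
Proof. exact/e_small/(ker_eq0 (n : submod ker_closed)). Qed.

Lemma ker_f2_bar (n : restr v2 kerL) : pbp2 S (ker_f2 n) = 0.
Proof. by rewrite -[RHS](ker_f1_bar n) -pbmod_eq. Qed.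

Definition ker_hom : pbhom (id_pbdiag v1 v2 kerL) S :=
  PbHom (K := id_pbdiag v1 v2 kerL) (pbf1 := ker_f1) (pbf2 := ker_f2) (pbfbar := \0)
        ker_f1_bar ker_f2_bar.

(** The pullback of the two identity maps is the diagonal copy of the kernel. *)
Lemma ker_hom_im x : e x = 0 <-> exists k, pbmap ker_hom k = x.
Proof.
split=> [/eqP ex|[k <-]].
  pose n : kerL := (Submod (ex : x \in submod_pred ker_closed)).
  have eq_n : pbp1 (id_pbdiag v1 v2 kerL) n = pbp2 (id_pbdiag v1 v2 kerL) n by [].
  by exists (pb_pair eq_n); apply: pbmod_inj.
have k12 : (val k).1 = (val k).2 :> kerL by exact: (pbmod_eq k).
rewrite -[RHS](ker_eq0 ((val k).1 : submod ker_closed)); congr (e _).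
apply: pbmod_inj => //.
exact: (esym (congr1 (fun n : kerL => (val (kerL_val n)).2) k12)).
Qed.

Lemma id_separated (L : lmodType Rbar) : separated (id_pbdiag v1 v2 L).
Proof.
split=> /= [y|y|x|x]; try by exists y.
all: split=> [x0|]; last exact: ker_smul_eq0.
all: exists 0, (fun _ => 0), (fun _ => 0).
all: by split=> [[]//|]; rewrite big_ord0.
Qed.

Lemma ker_presentation : separated S -> surj e -> separated_presentation M ker_hom.
Proof.
move=> sepS e_surj; split=> //; last exact: id_separated.
have pi0 x : e x = 0 -> coker_pi (pbmap ker_hom) x = 0.
  case/ker_hom_im=> k <-; rewrite -(linear0 (coker_pi (pbmap ker_hom))).
  by apply/coker_piP; exists k; rewrite subr0.
have [g gE] := factor_surj e_surj pi0.
exists g; apply: inj_surj_bij.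
- move=> m m'; have [x <-] := e_surj m; have [y <-] := e_surj m'.
  rewrite !gE => /coker_piP/ker_hom_im; rewrite linearB; exact: subr0_eq.
- by move=> q; have [x <-] := coker_pi_surj q; exists (e x); rewrite gE.
Qed.

End KernelPresentation.
End Presentation.

Theorem proposition5p3 (R1 R2 Rbar : pzRingType)
    (v1 : {rmorphism R1 -> Rbar}) (v2 : {rmorphism R2 -> Rbar})
    (v1_surj : surj v1) (v2_surj : surj v2)
    (Rbar_ss : semisimple_ring Rbar)
    (M : lmodType (pbring v1 v2)) :
  exists (K S : pbdiag v1 v2) (F : pbhom K S),
    [/\ separated_presentation M F,
        exists L : lmodType Rbar, K = id_pbdiag v1 v2 L,
        injective (pbf1 F), injective (pbf2 F)
      & forall x, pbfbar F x = 0].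
Proof.
have [S0 [e0 [sep0 surj0]]] := separated_cover v1_surj v2_surj M.
have [S1 [e1 [sep1 surj1 red1]]] := reduced_cover v1_surj v2_surj sep0 surj0.
have [S [e [sepS e_surj e_red e_small]]] :=
  small_kernel_cover v1_surj v2_surj Rbar_ss sep1 surj1 red1.
exists _, S, (ker_hom v1_surj v2_surj e_red e_small); split=> //.
- exact: ker_presentation.
- by eexists.
- exact: ker_f1_inj.
- exact: ker_f2_inj.
Qed.
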